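(* Let $n\ge 1$ and let $G$ be a graph with distinct vertex labels in $[n]$. Then for every $\pi\in L_G$ we have $\mu_L(\hat 0_n,\pi)\neq 0$, and $$Y_G=\sum_{\pi\in L_G}\mu_L(\hat 0_n,\pi)\,p_\pi .$$
   Context: All graphs are finite and simple. A graph $G$ with distinct vertex labels in $[n]=\{1,\dots,n\}$ is a graph with $n$ vertices labelled bijectively by $1,\dots,n$; write $v_i$ for the vertex labelled $i$. Let $x_1,x_2,\dots$ be noncommuting variables. A proper colouring of $G$ is a map $\kappa$ from the vertices to $\{1,2,\dots\}$ with $\kappa(u)\ne\kappa(v)$ whenever $u,v$ are adjacent. The chromatic symmetric function in noncommuting variables is $Y_G=\sum_\kappa x_{\kappa(v_1)}x_{\kappa(v_2)}\cdots x_{\kappa(v_n)}\in\mathbb{Q}\langle\langle x_1,x_2,\dots\rangle\rangle$, summed over all proper colourings $\kappa$ of $G$. A set partition $\pi$ of $[n]$, written $\pi=B_1/\cdots/B_\ell\vdash[n]$, is a family of disjoint nonempty sets (blocks) with union $[n]$. Set partitions are ordered by refinement: $\pi\le\sigma$ iff every block of $\pi$ is contained in a block of $\sigma$. $\hat 0_n=1/2/\cdots/n$ is the partition into singletons. For $\pi\vdash[n]$, the power sum symmetric function is $p_\pi=\sum_{(i_1,\dots,i_n)}x_{i_1}\cdots x_{i_n}$, over all tuples of positive integers with $i_j=i_k$ whenever $j,k$ are in the same block of $\pi$. A connected partition of $G$ is a set partition $\pi=B_1/\cdots/B_\ell\vdash[n]$ such that for each $i$ the subgraph of $G$ induced by the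 vertices with labels in $B_i$ is connected. The lattice of contractions $L_G$ is the set of all connected partitions of $G$, partially ordered by refinement, and $\mu_L$ is the Möbius function of the poset $L_G$. *)

(* Defs.v *)
From HB Require Import structures.
From mathcomp Require Import all_boot all_order all_algebra.
From mathcomp Require Import all_classical.
(* Re-imported so that partition, set0, trivIset, ... are those of finset. *)
From mathcomp Require Import finset.

Set Implicit Arguments.
Unset Strict Implicit.
Unset Printing Implicit Defensive.

Import Order.TTheory GRing.Theory Num.Theory.
Local Open Scope ring_scope.

(* The labels 1, ..., n are represented by the elements 0, ..., n.-1 of 'I_n. *)

Record labelled_graph (n : nat) (V : finType) := LabelledGraph {
  adj : rel V;
  adj_sym : symmetric adj;
  adj_irrefl : irreflexive adj;
  vertex : 'I_n -> V;
  vertex_bij : bijective vertex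
}.

(* Elements of Q<<x_1, x_2, ...>>, given by their coefficients on words.  The  *)
(* letter i : nat stands for the variable x_(i+1), so that nat plays the role *)
(* of the positive integers, as indices as well as colours.  The rational     *)
(* vector space structure is the pointwise one on functions.                  *)
Definition ncseries := seq nat -> rat^o.

Definition monomial (w : seq nat) : ncseries := fun u => (u == w)%:R.

(* Coefficientwise sum of a possibly infinite family of series.  As a finitely *)
(* supported sum is 0 when the support is infinite, this is meaningful only if *)
(* each word has a nonzero coefficient in finitely many members of the family; *)
(* locally_finite_monomials shows that this holds in every use below.          *)
Definition series_sum (I : choiceType) (A : set I) (f : I -> ncseries) :
  ncseries := fun u => \sum_(i \in A) f i u.

Lemma locally_finite_monomials (I : choiceType) (A : set I) (w : I -> seq nat) :
  injective w ->
  forall u, finite_set [set i | A i /\ monomial (w i) u != 0]%classic.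
Proof.
move=> w_inj u; have [[i0 /eqP ui0]|noi] := pselect (exists i, u == w i).
  apply: (@sub_finite_set _ _ [set i0]%classic); last exact: finite_set1.
  move=> i [_]; rewrite /monomial; case: (u =P w i) => [ui _|_ /eqP//].
  by apply: w_inj; rewrite -ui -ui0.
rewrite (_ : [set i | _]%classic = classical_sets.set0) ?finite_set0//.
apply/seteqP; split=> // i [_]; rewrite /monomial.
by case: (u =P w i) => [ui|_ /eqP//]; case: noi; exists i; apply/eqP.
Qed.

Section ChromaticSymmetricFunction.
Variables (n : nat) (V : finType) (G : labelled_graph n V).

Definition proper_colouring (k : {ffun V -> nat}) : Prop :=
  forall u v : V, adj G u v -> k u <> k v.

Definition colour_word (k : {ffun V -> nat}) : seq nat :=
  [tuple k (vertex G i) | i < n].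

Lemma colour_word_inj : injective colour_word.
Proof.
move=> k l /val_inj kl; apply/ffunP => v.
have [g _ gK] := vertex_bij G; rewrite -(gK v).
by have := congr1 (fun t => tnth t (g v)) kl; rewrite !tnth_mktuple.
Qed.

Definition chromatic_nc : ncseries :=
  series_sum [set k | proper_colouring k]%classic
    (fun k => monomial (colour_word k)).

End ChromaticSymmetricFunction.

Section SetPartitions.
Variable n : nat.

Record setpart := SetPart {
  blocks :> {set {set 'I_n}};
  blocksP : partition blocks [set: 'I_n]
}.

HB.instance Definition _ := [isSub for blocks].
HB.instance Definition _ := [Finite of setpart by <:].

Definition refines (p q : setpart) : bool :=
  [forall B in blocks p, exists C in blocks q, B \subset C].

Lemma refines_refl : reflexive refines.
Proof.
by move=> p; apply/forall_inP => B pB; apply/exists_inP; exists B.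
Qed.

Lemma refines_trans : transitive refines.
Proof.
move=> q p r /forall_inP pq /forall_inP qr; apply/forall_inP => B /pq.
case/exists_inP => C /qr /exists_inP[D rD CD] BC.
by apply/exists_inP; exists D => //; apply: fintype.subset_trans BC CD.
Qed.

Lemma refines_sub (p q : setpart) :
  refines p q -> refines q p -> blocks p \subset blocks q.
Proof.
move=> /forall_inP pq /forall_inP qp; apply/fintype.subsetP => B pB.
have /exists_inP[C qC BC] := pq B pB; have /exists_inP[D pD CD] := qp C qC.
case/and3P: (blocksP p) => _ tIp p0.
have [x xB] : exists x, x \in B.
  by apply/set0Pn; apply: contraNneq p0 => <-.
have BD : B = D.
  rewrite -(def_pblock tIp pB xB); apply: (def_pblock tIp pD).
  exact: (fintype.subsetP CD) _ (fintype.subsetP BC _ xB).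
suff -> : B = C by [].
by apply/eqP; rewrite eqEsubset BC {1}BD CD.
Qed.

Lemma refines_anti : antisymmetric refines.
Proof.
move=> p q /andP[pq qp]; apply: val_inj; apply/eqP.
by rewrite eqEsubset !refines_sub.
Qed.

Fact setpart_display : Order.disp_t. Proof. exact: Order.Disp tt tt. Qed.

HB.instance Definition _ := Order.Le_isPOrder.Build setpart_display setpart
  refines_refl refines_anti refines_trans.

Lemma singletons_partition :
  partition [set [set i] | i : 'I_n]%SET [set: 'I_n]%SET.
Proof.
apply/and3P; split.
- apply/eqP/setP => i; rewrite inE; apply/bigcupP.
  by exists [set i]%SET; rewrite ?inE //; apply: imset_f.
- apply/trivIsetP => _ _ /imsetP[i _ ->] /imsetP[j _ ->] ij.
  by rewrite disjoints1 inE; apply: contraNneq ij => ->.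
- apply/imsetP => -[i _ /setP/(_ i)]; by rewrite !inE eqxx.
Qed.

Definition singletons : setpart := SetPart singletons_partition.

Definition constant_on_blocks (p : setpart) (t : n.-tuple nat) : Prop :=
  forall B, B \in blocks p -> {in B &, forall j k, tnth t j = tnth t k}.

Definition power_sum (p : setpart) : ncseries :=
  series_sum [set t | constant_on_blocks p t]%classic
    (fun t : n.-tuple nat => monomial t).

End SetPartitions.

Section Contractions.
Variables (n : nat) (V : finType) (G : labelled_graph n V).

Definition induced_connected (S : {set V}) : bool :=
  [forall u in S, forall v in S,
     connect [rel x y | [&& x \in S, y \in S & adj G x y]] u v].

Definition connected_partition (p : setpart n) : bool :=
  [forall B in blocks p, induced_connected (vertex G @: B)].

Record contraction := Contraction {
  contraction_part :> setpart n;
  contraction_partP : connected_partition contraction_part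
}.

HB.instance Definition _ := [isSub for contraction_part].
HB.instance Definition _ := [Finite of contraction by <:].
HB.instance Definition _ :=
  [SubChoice_isSubPOrder of contraction by <: with setpart_display].

Lemma singletons_connected : connected_partition (singletons n).
Proof.
apply/forall_inP => _ /imsetP[i _ ->]; rewrite imset_set1.
apply/forall_inP => u /set1P ->; apply/forall_inP => v /set1P ->.
exact: connect0.
Qed.

Definition contraction0 : contraction := Contraction singletons_connected.

End Contractions.

Section Mobius.
Variables (d : Order.disp_t) (P : finPOrderType d).

(* The first argument bounds the depth of the recursion; #|P| is enough, as    *)
(* mobiusE shows.                                                              *)
Fixpoint mobius_rec (k : nat) (x y : P) : int :=
  if k is k'.+1 then
    if x == y then 1
    else if (x < y)%O then - \sum_(z : P | (x <= z < y)%O) mobius_rec k' x z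
    else 0
  else 0.

Definition mobius : P -> P -> int := mobius_rec #|P|.

Lemma mobius_rec_stable (k l : nat) (x y : P) :
  (#|[pred z : P | (z <= y)%O]| <= k)%N ->
  (#|[pred z : P | (z <= y)%O]| <= l)%N ->
  mobius_rec k x y = mobius_rec l x y.
Proof.
have y_gt0 y' : (0 < #|[pred z : P | (z <= y')%O]|)%N.
  by apply/card_gt0P; exists y'; rewrite inE.
elim: k l y => [|k IHk] [|l] y; rewrite ?leqn0 ?(gtn_eqF (y_gt0 _))//.
move=> yk yl /=; case: ifP => // _; case: ifP => // _.
congr (- _); apply: eq_bigr => z /andP[_ zy].
have lt_zy : (#|[pred t : P | (t <= z)%O]| < #|[pred t : P | (t <= y)%O]|)%N.
  apply: proper_card; apply/properP; split.
    apply/fintype.subsetP => t; rewrite !inE => tz.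
    exact: le_trans tz (ltW zy).
  by exists y; rewrite !inE ?lexx// -?ltNge ?lt_geF.
by apply: IHk; rewrite -ltnS; apply: leq_trans lt_zy _.
Qed.

Lemma mobiusE (x y : P) :
  mobius x y =
    if x == y then 1
    else if (x < y)%O then - \sum_(z : P | (x <= z < y)%O) mobius x z
    else 0.
Proof.
rewrite /mobius (@mobius_rec_stable _ #|P|.+1) ?max_card//.
exact: leqW (max_card _).
Qed.

End Mobius.

(* Main.v *)
(* On a word t, the partitions p in L_G for which p_p(t) = 1 are those below *)
(* the partition s into components of the graph of monochromatic edges, so   *)
(* the coefficient of t on the right is the sum of mu(0, p) over p <= s,     *)
(* which is 1 if s = 0, i.e. if t is proper, and 0 otherwise.                *)
(* For the nonvanishing, mu(0, p) has sign (-1)^(n - #blocks): given an edge *)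
(* e inside a block of p, Weisner's theorem expresses mu(0, p) as minus the  *)
(* sum of mu(0, x) over the x < p whose join with e is p; these x all have   *)
(* one block more than p, and there is at least one of them.                 *)

Require Import Defs.
From HB Require Import structures.
From mathcomp Require Import all_boot all_order all_algebra.
From mathcomp Require Import all_classical.
From mathcomp Require Import finset.

Set Implicit Arguments.
Unset Strict Implicit.
Unset Printing Implicit Defensive.

Import Order.TTheory GRing.Theory Num.Theory.
Local Open Scope ring_scope.

(** A set partition is handled as the equivalence relation [same_block]. For an element of L_G this
    relation is generated by the edges inside blocks ([same_block_connect]), so two such partitions
    are compared edge by edge ([le_contractionP]).

    The expansion is checked word by word: [monochromatic_components] turns the coefficients on both
    sides into conditions on a single element s of L_G, and [sum_mobius] equates them.

    The nonvanishing follows from the stronger [mobius_sign]. By [weisner], applied to the join with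
    one edge, mu(0, p) is minus a sum of values that all have the same sign by induction
    ([card_join_edge]), and this sum is not empty by [join_edge_surj]. *)

Lemma connect_ind (T : finType) (r : rel T) (Q : T -> Prop) (x y : T) :
  connect r x y -> Q x -> (forall z t, Q z -> r z t -> Q t) -> Q y.
Proof.
move=> /connectP[s rs ->] Qx Qr; elim: s x Qx rs => //= z s IHs x Qx.
by case/andP=> rxz; apply: IHs; apply: Qr rxz.
Qed.

(** * Möbius function of a finite poset with a bottom *)

Section MobiusSums.
Variables (d : Order.disp_t) (P : finPOrderType d).

Lemma finpo_ind (Q : P -> Prop) :
  (forall y, (forall z, (z < y)%O -> Q z) -> Q y) -> forall y, Q y.
Proof.
move=> IH y; have [k] := ubnP #|[pred z : P | (z <= y)%O]|.
elim: k y => // k IHk y /ltnSE yk; apply: IH => z zy; apply: IHk.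
apply: leq_trans yk; apply: proper_card; apply/properP; split.
  by apply/fintype.subsetP => t; rewrite !inE => /le_trans; apply; apply: ltW.
by exists y; rewrite !inE // lt_geF.
Qed.

(** The uniqueness half of Möbius inversion, which is what [weisner] rests on. *)
Lemma eq0_of_lower_sums (f : P -> int) :
  (forall y, \sum_(z | (z <= y)%O) f z = 0) -> forall y, f y = 0.
Proof.
move=> f0; apply: finpo_ind => y IH; have := f0 y.
rewrite (bigD1 y) //= big1 ?addr0 // => z /andP[zy z_y].
by apply: IH; rewrite lt_neqAle z_y.
Qed.

Variable o : P.
Hypothesis o_bot : forall x : P, (o <= x)%O.

Lemma sum_mobius (y : P) : \sum_(z | (z <= y)%O) mobius o z = (y == o)%:R.
Proof.
rewrite (bigD1 y) //= mobiusE eq_sym; case: eqVneq => [->|yo].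
  by rewrite big1 ?addr0 // => z /andP[zo]; rewrite eq_le zo o_bot.
rewrite lt_neqAle eq_sym yo o_bot /= addrC.
rewrite (eq_bigl (fun z => (o <= z < y)%O)) ?subrr // => z.
by rewrite o_bot lt_neqAle andbC.
Qed.

(* Weisner's theorem for the join [j] with a fixed element [a <> o], given by *)
(* [j x <= y <-> x <= y /\ a <= y]; here [Q y] plays the role of [a <= y].    *)
Lemma weisner (Q : pred P) (j : P -> P) :
  (forall x y, (j x <= y)%O = (x <= y)%O && Q y) -> ~~ Q o ->
  forall y, \sum_(x | j x == y) mobius o x = 0.
Proof.
move=> jP Qo; apply: eq0_of_lower_sums => y.
(* For z <= y, [j x = z] forces [j x <= y], so the fibres add up to the sum over all x with
   [j x <= y]. By [jP] this is either empty or the full lower sum at y, which vanishes because y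
   differs from o. *)
rewrite (eq_bigr (fun z => \sum_(x | (j x <= y)%O && (j x == z)) mobius o x)).
  rewrite -(partition_big j (fun z => z <= y)%O) //.
  under eq_bigl do rewrite jP.
  have [Qy|_] := boolP (Q y); last by rewrite big_pred0 // => x; rewrite andbF.
  under eq_bigl do rewrite andbT; rewrite sum_mobius.
  by case: eqP Qo => // <-; rewrite Qy.
by move=> z zy; apply: eq_bigl => x; case: eqP => [->|]; rewrite ?zy ?andbF.
Qed.

End MobiusSums.

(** * Set partitions as equivalence relations *)

Section SameBlock.
Variable n : nat.
Implicit Types (p q : setpart n) (i j k : 'I_n).

Definition same_block p i j := pblock p i == pblock p j.

Lemma mem_pblockE p i j : (j \in pblock p i) = same_block p i j.
Proof.
have /and3P[/eqP cp tp _] := blocksP p.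
by rewrite /same_block eq_pblock // cp inE.
Qed.

Lemma pblock_blocks p i : pblock p i \in blocks p.
Proof. by rewrite pblock_mem // (cover_partition (blocksP p)) inE. Qed.

Lemma same_blockC p i j : same_block p i j = same_block p j i.
Proof. exact: eq_sym. Qed.

Lemma same_block_trans p : transitive (same_block p).
Proof. by move=> j i k /eqP ij /eqP jk; apply/eqP; rewrite ij. Qed.

Lemma blocks_pblock p B : B \in blocks p -> exists2 i, i \in B & B = pblock p i.
Proof.
move=> pB; have /and3P[_ tp p0] := blocksP p.
have /set0Pn[i iB] : B != set0 by apply: contraNneq p0 => <-.
by exists i => //; rewrite (def_pblock tp pB iB).
Qed.

Lemma le_setpartP p q :
  reflect (forall i j, same_block p i j -> same_block q i j) (p <= q)%O.
Proof.
apply: (iffP forall_inP) => [pq i j|pq B /blocks_pblock[i _ ->]].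
  rewrite -mem_pblockE => ij.
  have /exists_inP[C qC /fintype.subsetP BC] := pq _ (pblock_blocks p i).
  have /and3P[_ tq _] := blocksP q.
  rewrite -mem_pblockE (def_pblock tq qC (x := i)) ?BC //.
  by rewrite mem_pblockE /same_block.
apply/exists_inP; exists (pblock q i); first exact: pblock_blocks.
by apply/fintype.subsetP => j; rewrite !mem_pblockE => /pq.
Qed.

Lemma same_block_singletons i j : same_block (singletons n) i j = (i == j).
Proof.
rewrite -mem_pblockE.
have /and3P[_ t _] := blocksP (singletons n).
by rewrite (def_pblock (B := [set i]) t) ?inE ?imset_f // eq_sym.
Qed.

Lemma constant_on_blocksP p (t : n.-tuple nat) :
  constant_on_blocks p t <->
  forall i j, same_block p i j -> tnth t i = tnth t j.
Proof.
split=> [pt i j ij|pt B /blocks_pblock[i _ ->] j k].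
  by apply: (pt _ (pblock_blocks p i)); rewrite mem_pblockE // /same_block.
rewrite !mem_pblockE => ij ik; apply: pt; apply: same_block_trans ik.
by rewrite same_blockC.
Qed.

(** The distinct blocks of a and b fuse into their union and all other blocks survive, so exactly
    one block is lost. *)
Lemma card_blocks_merge p q a b :
  ~~ same_block p a b ->
  (forall i j, same_block q i j =
     [|| same_block p i j, same_block p i a && same_block p b j
       | same_block p i b && same_block p a j]) ->
  #|blocks p| = #|blocks q|.+1.
Proof.
move=> ab qE; pose A := pblock p a; pose B := pblock p b.
have AB : A != B by [].
have qa : pblock q a = A :|: B.
  apply/setP => i; rewrite inE !mem_pblockE qE (negPf ab) /same_block eqxx.
  by rewrite orbF.
have qi i : ~~ same_block p i a -> ~~ same_block p i b ->
    pblock q i = pblock p i.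
  move=> ia ib; apply/setP => j.
  by rewrite !mem_pblockE qE (negPf ia) (negPf ib) !orbF.
have qb : pblock q b = A :|: B.
  rewrite -qa; apply/eqP; rewrite -/(same_block q b a) qE /same_block !eqxx.
  by rewrite !orbT.
have qU : blocks q = (A :|: B) |: (blocks p :\: [set A; B]).
  apply/setP => C; rewrite !inE; apply/idP/idP.
    case/blocks_pblock=> i _ ->.
    have [ia|ia] := boolP (same_block p i a).
      suff -> : pblock q i = A :|: B by rewrite eqxx.
      by rewrite -qa; apply/eqP; rewrite -/(same_block q i a) qE ia.
    have [ib|ib] := boolP (same_block p i b).
      suff -> : pblock q i = A :|: B by rewrite eqxx.
      by rewrite -qb; apply/eqP; rewrite -/(same_block q i b) qE ib.
    by rewrite qi // pblock_blocks andbT negb_or; apply/orP; right; apply/andP.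
  case/predU1P=> [->|]; first by rewrite -qa pblock_blocks.
  rewrite negb_or => /andP[/andP[CA CB] /blocks_pblock[i _ Ci]].
  by rewrite Ci -qi ?pblock_blocks // /same_block -Ci.
(* The union is a new block: as a block of p it would contain a and hence equal A. *)
have UN : A :|: B \notin blocks p :\: [set A; B].
  rewrite !inE negb_or; apply/negP => /andP[/andP[UA _] pU].
  have /and3P[_ tp _] := blocksP p; case/eqP: UA.
  rewrite -(def_pblock tp pU (x := a)) //.
  by rewrite inE mem_pblockE /same_block eqxx.
rewrite qU cardsU1 UN add1n -(cardsID [set A; B]) -addn2 addnC.
suff /setIidPr -> : [set A; B] \subset blocks p by rewrite cards2 AB.
apply/fintype.subsetP => C; rewrite !inE => /orP[] /eqP ->;
  exact: pblock_blocks.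
Qed.

Lemma setpart_of_equivalence (R : rel 'I_n) :
  equivalence_rel R -> {p : setpart n | forall i j, same_block p i j = R i j}.
Proof.
move=> eR; have eR' : {in [set: 'I_n] & &, equivalence_rel R}.
  by move=> x y z _ _ _; apply: eR.
exists (SetPart (equivalence_partitionP eR')) => i j.
by rewrite -mem_pblockE pblock_equivalence_partition ?inE.
Qed.

End SameBlock.

(** * The lattice of contractions and joins with an edge *)

Section Contractions.
Variables (n : nat) (V : finType) (G : labelled_graph n V).
Implicit Types (p q x : contraction G) (i j a b : 'I_n).

Definition edge : rel 'I_n := fun i j => adj G (vertex G i) (vertex G j).

Lemma edge_sym : symmetric edge.
Proof. by move=> i j; apply: adj_sym. Qed.

(** This is how connectedness of the blocks is used: a path in the induced subgraph on a block,
    pulled back to labels, stays inside that block. *)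
Lemma same_block_connect p i j :
  same_block p i j = connect [rel k l | edge k l && same_block p k l] i j.
Proof.
apply/idP/idP; last first.
  move/(connect_ind (Q := same_block p i)); apply; first exact: eqxx.
  by move=> k l ik /andP[_]; apply: same_block_trans.
have [g vK gK] := vertex_bij G.
rewrite -mem_pblockE => ij.
have /forall_inP/(_ _ (pblock_blocks p i))/forall_inP c := contraction_partP p.
have ii : i \in pblock p i by rewrite mem_pblockE /same_block.
have /forall_inP/(_ _ (imset_f (vertex G) ij)) {}c :=
  c _ (imset_f (vertex G) ii).
rewrite -(vK j); set r := (r in connect r).
apply: (connect_ind (Q := fun v => connect r i (g v)) c) => [|u v /[swap]].
  by rewrite vK connect0.
case/and3P=> /imsetP[k ik ->] /imsetP[l il ->] kl.
rewrite !vK => /connect_trans; apply; apply: connect1; rewrite /r /= /edge kl.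
by move: ik il; rewrite !mem_pblockE /same_block => /eqP <-.
Qed.

Lemma le_contractionP p q :
  reflect (forall i j, edge i j -> same_block p i j -> same_block q i j)
    (p <= q)%O.
Proof.
apply: (iffP (le_setpartP p q)) => [pq i j _ /pq //|pq i j].
rewrite same_block_connect.
move/(connect_ind (Q := same_block q i)); apply; first exact: eqxx.
by move=> k l ik /andP[kl /(pq _ _ kl)]; apply: same_block_trans.
Qed.

Lemma connected_partition_of (p : setpart n) (r : rel 'I_n) :
  subrel r edge -> (forall i j, same_block p i j = connect r i j) ->
  connected_partition G p.
Proof.
move=> re pE; apply/forall_inP => _ /blocks_pblock[i _ ->].
apply/forall_inP => _ /imsetP[j ij ->]; apply/forall_inP => _ /imsetP[k ik ->].
set R := (R in connect R _ _).
have jk : connect r j k.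
  by rewrite -pE /same_block; move: ij ik; rewrite !mem_pblockE => /eqP <-.
(* Membership in the block is carried along the path because [R] only has steps between vertices of
   the block. *)
pose Q l := l \in pblock p i /\ connect R (vertex G j) (vertex G l).
suff [] : Q k by [].
apply: (connect_ind (Q := Q) jk) => [|l m [il jl] lm].
  by split=> //; apply: connect0.
have im : m \in pblock p i.
  move: il; rewrite !mem_pblockE => /same_block_trans; apply.
  by rewrite pE connect1.
split=> //; apply: connect_trans jl (connect1 _).
by rewrite /R /= !imset_f //; apply: re.
Qed.

(** The source of the contractions built below: the join with an edge and the monochromatic
    partition are both component partitions of a subgraph of G. *)
Lemma components_ex (r : rel 'I_n) :
  symmetric r -> subrel r edge ->
  {p : contraction G | forall i j, same_block p i j = connect r i j}.
Proof.
move=> r_sym re; have eR : equivalence_rel (connect r).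
  split=> [|xy]; first exact: connect0.
  exact: (same_connect (sym_connect_sym r_sym)).
have [p pE] := setpart_of_equivalence eR.
by exists (Contraction (connected_partition_of re pE)).
Qed.

Lemma contraction0_le p : (contraction0 G <= p)%O.
Proof.
apply/le_contractionP => i j _; rewrite same_block_singletons => /eqP ->.
exact: eqxx.
Qed.

(** Adding the edge ab to the edges inside the blocks of x can only fuse the blocks of a and b,
    which gives the join an explicit relation. *)
Lemma join_edge_ex x a b : edge a b ->
  {q : contraction G | forall i j, same_block q i j =
     [|| same_block x i j, same_block x i a && same_block x b j
       | same_block x i b && same_block x a j]}.
Proof.
move=> ab.
pose r := [rel i j | edge i j &&
  [|| same_block x i j, (i == a) && (j == b) | (i == b) && (j == a)]].
have r_sym : symmetric r.
  move=> i j /=; rewrite edge_sym same_blockC; congr (_ && (_ || _)).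
  by rewrite orbC andbC [X in _ || X]andbC.
have re : subrel r edge by move=> i j /andP[].
have [q qE] := components_ex r_sym re.
have cx i j : same_block x i j -> connect r i j.
  rewrite same_block_connect; apply: connect_sub => k l /andP[kl xkl].
  by apply: connect1; rewrite /r /= kl xkl.
have cab : connect r a b by apply: connect1; rewrite /r /= ab !eqxx orbT.
have cba : connect r b a by rewrite (sym_connect_sym r_sym).
exists q => i j; rewrite qE; apply/idP/idP; last first.
  case/or3P=> [/cx //|/andP[/cx ia /cx bj]|/andP[/cx ib /cx aj]].
    exact: connect_trans ia (connect_trans cab bj).
  exact: connect_trans ib (connect_trans cba aj).
move/(connect_ind (Q := fun j => [|| same_block x i j,
  same_block x i a && same_block x b j
    | same_block x i b && same_block x a j])).
apply=> [|k l + /andP[_]]; first by rewrite /same_block eqxx.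
rewrite /same_block => ik.
case/or3P=> [/eqP <- //|/andP[/eqP ka /eqP ->]|/andP[/eqP kb /eqP ->]].
  by move: ik; rewrite ka !eqxx !andbT => /or3P[->|/andP[->]|->]; rewrite ?orbT.
by move: ik; rewrite kb !eqxx !andbT => /or3P[->|->|/andP[->]]; rewrite ?orbT.
Qed.

(** Without such an edge, the edgewise test [le_contractionP] would hold vacuously and put p below
    the bottom. *)
Lemma same_block_edge p :
  p != contraction0 G -> {ab | edge ab.1 ab.2 & same_block p ab.1 ab.2}.
Proof.
move=> p0; apply: sig2W; apply: contrapT => np; case/negP: p0.
rewrite eq_le contraction0_le andbT; apply/le_contractionP => i j ij pij.
by case: np; exists (i, j).
Qed.

Section JoinEdge.
Variables a b : 'I_n.
Hypothesis ab : edge a b.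

Definition join_edge x := sval (join_edge_ex x ab).

Lemma same_block_join x i j : same_block (join_edge x) i j =
  [|| same_block x i j, same_block x i a && same_block x b j
    | same_block x i b && same_block x a j].
Proof. exact: (svalP (join_edge_ex x ab)). Qed.

(** The universal property of the join, in the form that [weisner] takes. *)
Lemma join_edge_le x p : (join_edge x <= p)%O = (x <= p)%O && same_block p a b.
Proof.
apply/idP/andP => [/le_setpartP xp|[/le_setpartP xp pab]].
  split; last by apply: xp; rewrite same_block_join /same_block !eqxx orbT.
  by apply/le_setpartP => i j ij; apply: xp; rewrite same_block_join ij.
apply/le_setpartP => i j; rewrite same_block_join.
have tr := @same_block_trans _ p.
case/or3P=> [/xp //|/andP[/xp ia /xp bj]|/andP[/xp ib /xp aj]].
  exact: tr _ _ _ ia (tr _ _ _ pab bj).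
by rewrite same_blockC in pab; apply: tr _ _ _ ib (tr _ _ _ pab aj).
Qed.

Lemma le_join_edge x : (x <= join_edge x)%O.
Proof. by have := lexx (join_edge x); rewrite join_edge_le => /andP[]. Qed.

Lemma join_edge_id p : same_block p a b -> join_edge p = p.
Proof.
by move=> pab; apply: le_anti; rewrite join_edge_le lexx pab le_join_edge.
Qed.

Lemma card_join_edge x :
  ~~ same_block x a b -> #|blocks x| = #|blocks (join_edge x)|.+1.
Proof. by move=> xab; apply: card_blocks_merge xab (same_block_join x). Qed.

End JoinEdge.

Lemma edge_neq a b : edge a b -> a != b.
Proof. by apply: contraTneq => ->; rewrite /edge adj_irrefl. Qed.

(* Among the lower bounds of [p] separating [a] from [b], take [x] with the   *)
(* fewest blocks: an edge within [p] but not within the join would give, when *)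
(* joined to [x], a coarser such lower bound.                                 *)
Lemma join_edge_surj p a b (ab : edge a b) : same_block p a b ->
  exists2 x : contraction G, ~~ same_block x a b & join_edge ab x = p.
Proof.
move=> pab.
pose S (x : contraction G) := (x <= p)%O && ~~ same_block x a b.
have S0 : S (contraction0 G).
  by rewrite /S contraction0_le same_block_singletons edge_neq.
have [x /andP[xp xab] x_min] :=
  arg_minnP (fun x : contraction G => #|blocks x|) S0.
exists x => //; apply: le_anti; rewrite join_edge_le xp pab /=.
apply/le_contractionP => i j ij pij; apply/negPn/negP => nij.
have xij : ~~ same_block x i j.
  by apply: contra nij => xij; rewrite same_block_join xij.
have Sy : S (join_edge ij x).
  rewrite /S join_edge_le xp pij /=; apply: contra nij.
  rewrite !same_block_join (negPf xab) /= => /orP[/andP[ai jb]|/andP[ai jb]].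
    by rewrite (same_blockC x i a) ai (same_blockC x b j) jb orbT.
  by rewrite ai jb !orbT.
by have := x_min _ Sy; rewrite (card_join_edge ij xij) ltnn.
Qed.

(** The exponent has the parity of the rank n - #blocks while avoiding truncated subtraction. A
    strict sign, unlike mere nonvanishing, lets the induction exclude cancellation. *)
Lemma mobius_sign p : 0 < (-1) ^+ (n + #|blocks p|) * mobius (contraction0 G) p.
Proof.
elim/finpo_ind: p => p IH.
have [->|/same_block_edge[[a b] /= ab pab]] := eqVneq p (contraction0 G).
  rewrite mobiusE eqxx mulr1 /= card_imset ?card_ord; last exact: set1_inj.
  by rewrite addnn -signr_odd odd_double.
have := weisner contraction0_le (join_edge_le ab) _ p.
rewrite same_block_singletons edge_neq // => /(_ isT).
rewrite (bigD1 p) /=; last by rewrite join_edge_id.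
move/eqP; rewrite addr_eq0 => /eqP ->.
(* Such an x separates a from b, since otherwise it would equal its join p. Hence it has exactly one
   block more than p, and the sign flip absorbs the minus. *)
have px x : (join_edge ab x == p) && (x != p) ->
    0 < (-1) ^+ (n + #|blocks p|) * - mobius (contraction0 G) x.
  case/andP=> /eqP jx xp.
  have {}xp : (x < p)%O by rewrite lt_neqAle xp -jx le_join_edge.
  have xab : ~~ same_block x a b.
    by apply: contraTN (xp) => xab; rewrite -jx join_edge_id // ltxx.
  move: (IH x xp); rewrite (card_join_edge ab xab) jx addnS exprS.
  by rewrite mulN1r mulrN mulNr.
rewrite -sumrN mulr_sumr.
(* All terms are positive; one witness makes the sum strictly positive. *)
have [x xab jx] := join_edge_surj ab pab.
have xJ : (join_edge ab x == p) && (x != p).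
  by rewrite jx eqxx /=; apply: contraNneq xab => ->.
rewrite (bigD1 x) //= ltr_pwDl ?px //.
by apply: sumr_ge0 => y /andP[/px/ltW].
Qed.

End Contractions.

(** * Coefficients of the series and the expansion *)

(** By injectivity at most one member of the family meets a given word, so each coefficient is 0 or
    1. *)
Lemma series_sum_monomial (I : choiceType) (A : set I) (w : I -> seq nat) u :
  injective w ->
  series_sum A (fun i => monomial (w i)) u = `[< exists2 i, A i & u = w i >]%:R.
Proof.
move=> w_inj; rewrite /series_sum; case: asboolP => [[i Ai ui]|no].
  rewrite -(@fsbig_widen _ _ _ _ [set i]%classic).
  - by rewrite fsbig_set1 /monomial ui eqxx.
  - by move=> _ ->.
  - move=> j [_ ji]; rewrite /= /monomial; case: eqP => // uj.
    by case: ji; apply: w_inj; rewrite -ui.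
rewrite fsbig1 // => i Ai; rewrite /monomial; case: eqP => // ui.
by case: no; exists i.
Qed.

Section Coefficients.
Variables (n : nat) (V : finType) (G : labelled_graph n V).

Lemma power_sum_coef (p : setpart n) (u : n.-tuple nat) :
  power_sum p u = `[< constant_on_blocks p u >]%:R.
Proof.
rewrite /power_sum series_sum_monomial; last exact: val_inj.
congr (nat_of_bool _)%:R; apply: asbool_equiv_eq.
by split=> [[t pt /val_inj ->] //|pu]; exists u.
Qed.

Lemma chromatic_nc_coef (u : n.-tuple nat) :
  chromatic_nc G u =
    `[< forall i j, edge G i j -> tnth u i <> tnth u j >]%:R.
Proof.
rewrite /chromatic_nc series_sum_monomial; last exact: colour_word_inj.
congr (nat_of_bool _)%:R; apply: asbool_equiv_eq.
split=> [[k pk /val_inj ->] i j ij|pu].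
  by rewrite !tnth_mktuple; apply: pk.
have [g vK gK] := vertex_bij G.
(* The colouring is read off the word through the inverse labelling. *)
exists [ffun v => tnth u (g v)].
  by move=> v w vw; rewrite !ffunE; apply: pu; rewrite /edge !gK.
by congr val; apply: eq_from_tnth => i; rewrite tnth_mktuple ffunE vK.
Qed.

(* [s] is the partition into components of the graph of monochromatic edges. *)
Lemma monochromatic_components (u : n.-tuple nat) :
  {s : contraction G |
    (forall p : contraction G, constant_on_blocks p u <-> (p <= s)%O) &
    (forall i j, edge G i j -> tnth u i <> tnth u j) <-> s = contraction0 G}.
Proof.
pose r := [rel i j | edge G i j && (tnth u i == tnth u j)].
have r_sym : symmetric r by move=> i j /=; rewrite edge_sym eq_sym.
have re : subrel r (edge G) by move=> i j /andP[].
have [s sE] := components_ex r_sym re; exists s.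
  move=> p; rewrite constant_on_blocksP; split=> [pu|/le_setpartP ps i j /ps].
    apply/le_contractionP => i j ij /pu uij.
    by rewrite sE connect1 //= ij uij eqxx.
  rewrite sE => /(connect_ind (Q := fun j => tnth u i = tnth u j)); apply=> //.
  by move=> k l -> /andP[_ /eqP].
split=> [pu|s0 i j ij uij].
  apply: le_anti; rewrite contraction0_le andbT; apply/le_setpartP => i j.
  rewrite sE => /(connect_ind (Q := same_block (contraction0 G) i)).
  apply=> [|k l _ /andP[/pu + /eqP] //]; exact: eqxx.
have : same_block s i j by rewrite sE connect1 //= ij uij eqxx.
by rewrite s0 same_block_singletons (negPf (edge_neq ij)).
Qed.

End Coefficients.

Theorem theorem3p1 (n : nat) (V : finType) (G : labelled_graph n V) :
  (1 <= n)%N ->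
  (forall p : contraction G, mobius (contraction0 G) p != 0) /\
  chromatic_nc G =
    \sum_(p : contraction G) (mobius (contraction0 G) p)%:~R *: power_sum p.
Proof.
move=> _; split=> [p|].
  by have := mobius_sign p; apply: contraTneq => ->; rewrite mulr0 ltxx.
apply/funext => u; rewrite fct_sumE.
(* Every monomial involved has length n, so on words of another length both sides vanish. *)
have [un|un] := eqVneq (size u) n; last first.
  have u_notin (t : n.-tuple nat) : u <> t.
    by move=> ut; rewrite ut size_tuple eqxx in un.
  rewrite /chromatic_nc series_sum_monomial; last exact: colour_word_inj.
  rewrite asboolF; last by case=> k _ /u_notin.
  rewrite big1 // => p _; rewrite scalrfctE /power_sum.
  rewrite series_sum_monomial; last exact: val_inj.
  by rewrite asboolF ?scaler0 //; case=> t _ /u_notin.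
have [t ->] : exists t : n.-tuple nat, u = t.
  by exists (tcast un (in_tuple u)); rewrite val_tcast.
have [s sP s0] := monochromatic_components G t.
rewrite chromatic_nc_coef (asbool_equiv_eq s0).
have -> : `[< s = contraction0 G >] = (s == contraction0 G).
  exact/asboolP/eqP.
(* The indicator of s = 0 is the sum of mu(0, p) over p <= s; by [sP] these p are exactly those
   whose power sum has coefficient 1 at t. *)
have /(congr1 (intr : int -> rat)) := sum_mobius (@contraction0_le _ _ G) s.
rewrite rmorph_sum /= mulrz_nat => <-; rewrite big_mkcond.
apply: eq_bigr => p _.
rewrite scalrfctE power_sum_coef (asbool_equiv_eq (sP p)) asboolb.
by case: ifP => _; rewrite /= ?scaler0 // /GRing.scale /= mulr1.
Qed.
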